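(* Let $\Omega$ be a finite set (of genres), $p$ a probability distribution on $\Omega$, $M$ a finite set of movies where each $i \in M$ has a probability distribution $p(\cdot \mid i)$ on $\Omega$, $k \ge 1$ an integer, and $w_1 \ge w_2 \ge \dots \ge w_k \ge 0$ weights with $\sum_{j=1}^k w_j = 1$. For a sequence $I = i_1 \dots i_\ell$ of movies with $\ell \le k$, let $q_I(x) = \sum_{j=1}^{\ell} w_j\, p(x \mid i_j)$. Let $f:[0,\infty) \to [0,\infty)$ be nonnegative, non-decreasing and concave, differentiable with $f'(p(x)) > 0$ for all $x \in \Omega$, and define the overlap measure $$G(p,q) = \sum_{x \in \Omega} \frac{f(q(x))}{f'(p(x))}.$$ Then the sequence function $F(I) = G(p, q_I)$ is ordered-submodular, and consequently the greedy algorithm produces a length-$k$ list $A_k$ with $F(A_k) \ge \frac12 \max\{F(I) : I \text{ a sequence of } k \text{ movies}\}$.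
   Context: For sequences $A, B$, $A\|B$ denotes concatenation and $A\|s$ denotes $A$ with element $s$ appended. A function $F$ on sequences of movies is ordered-submodular if for all sequences $A, B$ and movies $s, \bar s$ (with all sequences involved of length at most $k$): $F(A\|s) - F(A) \ge F(A\|s\|B) - F(A\|\bar s\|B)$. The greedy algorithm: $A_0 = \emptyset$; for $\ell=1,\dots,k$, $A_\ell = A_{\ell-1}\|a$ where $a \in M$ maximizes $F(A_{\ell-1}\|a)$, ties broken arbitrarily. *)

(* Defs.v *)
From HB Require Import structures.
From mathcomp Require Import all_boot all_order all_algebra.
From mathcomp Require Import all_classical all_reals all_analysis.

Set Implicit Arguments.
Unset Strict Implicit.
Unset Printing Implicit Defensive.

Import Order.TTheory GRing.Theory Num.Theory.
Import numFieldNormedType.Exports.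

Local Open Scope classical_set_scope.
Local Open Scope ring_scope.

Definition is_distribution (R : realType) (T : finType) (p : T -> R) : Prop :=
  (forall x, 0 <= p x) /\ \sum_x p x = 1.

Section HalfLine.
Variable R : realType.
Implicit Types (f : R -> R) (a : R).

Definition halfline : set R := `[0, +oo[%classic.

(* A function [0, +oo[ -> R is represented by an f : R -> R of which only the
   values on [0, +oo[ matter.  Accordingly, increments h are restricted to those
   with a + h in [0, +oo[: the derivative is the usual one for a > 0, and the
   right derivative for a = 0. *)
Definition halfline_quotient f a : set_system R :=
  (fun h : R => h^-1 * (f (a + h) - f a))
    @ within [set h | halfline (a + h)] 0^'.

Definition halfline_derivable f a : Prop := cvg (halfline_quotient f a).

Definition halfline_deriv f a : R := lim (halfline_quotient f a).

Definition concave_function (D : set R) f : Prop :=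
  @convex_function R R^o D (fun x => - f x).

End HalfLine.

Arguments halfline R : clear implicits.

Definition overlap (R : realType) (Omega : finType) (f : R -> R)
    (p q : Omega -> R) : R :=
  \sum_(x : Omega) f (q x) / halfline_deriv f (p x).

(* Positions are numbered from 0: w j weighs the (j+1)-st movie of the list. *)
Definition mixture (R : realType) (Omega M : finType) (w : nat -> R)
    (pM : M -> Omega -> R) (I : seq M) (x : Omega) : R :=
  \sum_(j < size I) w j * pM (tnth (in_tuple I) j) x.

Section SequenceFunctions.
Variables (R : realType) (M : finType) (k : nat) (F : seq M -> R).

(* The size bound makes all the sequences involved have length at most k. *)
Definition ordered_submodular : Prop :=
  forall (A B : seq M) (s s' : M), (size A + 1 + size B <= k)%N ->
    F (rcons A s) - F A >= F (rcons A s ++ B) - F (rcons A s' ++ B).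

(* greedy l A: A is a possible value of the greedy list after l steps, for some
   way of breaking ties. *)
Inductive greedy : nat -> seq M -> Prop :=
| greedy_nil : greedy 0 [::]
| greedy_rcons l A a : greedy l A ->
    (forall b, F (rcons A b) <= F (rcons A a)) ->
    greedy l.+1 (rcons A a).

(* The neutral element 0 is harmless when F is nonnegative. *)
Definition max_value : R := \big[Num.max/0]_(I : k.-tuple M) F I.

End SequenceFunctions.

(* Main.v *)
(* Pointwise in the genre, concavity makes the gain of adding a movie at a fixed
   position shrink when later movies are present, and monotonicity lets the
   replacement movie be discarded; hence ordered submodularity.  For the greedy
   bound, replace an optimal list by the greedy one position after position: by
   ordered submodularity, each replacement loses at most what the corresponding
   greedy step gained, so that F(O) - F(A) <= F(A) - F([::]) <= F(A). *)
Require Import Defs.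
From HB Require Import structures.
From mathcomp Require Import all_boot all_order all_algebra.
From mathcomp Require Import all_classical all_reals all_analysis.
From mathcomp Require Import ring lra zify.

Set Implicit Arguments.
Unset Strict Implicit.
Unset Printing Implicit Defensive.

Import Order.TTheory GRing.Theory Num.Theory.
Import numFieldNormedType.Exports.

Local Open Scope classical_set_scope.
Local Open Scope ring_scope.

(** Both [a + b] and [a + c] lie between [a] and [a + b + c], as convex combinations whose weights
    [c / (b + c)] and [b / (b + c)] are swapped. Adding the two concavity inequalities makes the
    weights sum to 1 at each endpoint. *)
Lemma concave_increments (R : realType) (f : R -> R) (a b c : R) :
  concave_function (halfline R) f -> 0 <= a -> 0 <= b -> 0 <= c ->
  f (a + b + c) - f (a + c) <= f (a + b) - f a.
Proof.
move=> f_concave a0 b0 c0.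
(* The weights divide by [b + c], so the degenerate case is split off. *)
have [bc0|bc0] := eqVneq (b + c) 0.
  have -> : b = 0 by lra.
  by rewrite !addr0 !subrr.
have bc_gt0 : 0 < b + c by rewrite lt_def bc0 addr_ge0.
have in_halfline x : 0 <= x -> x \in halfline R.
  by move=> x0; rewrite inE /halfline /= in_itv /= x0.
have conc t : 0 <= t -> t <= 1 ->
    t * f a + (1 - t) * f (a + b + c) <= f (t * a + (1 - t) * (a + b + c)).
  move=> t0 t1.
  have abc0 : 0 <= a + b + c by rewrite !addr_ge0.
  have := f_concave (Itv01 t0 t1) _ _ (in_halfline _ a0) (in_halfline _ abc0).
  rewrite !convRE /= /unstable.onem => h.
  by rewrite -lerN2; apply: le_trans h _; rewrite !mulrN opprD.
have tb0 : 0 <= b / (b + c) by rewrite divr_ge0 // ltW.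
have tc0 : 0 <= c / (b + c) by rewrite divr_ge0 // ltW.
have tbc : b / (b + c) = 1 - c / (b + c) by field.
have tb1 : b / (b + c) <= 1 by lra.
have tc1 : c / (b + c) <= 1 by lra.
have := conc _ tb0 tb1; have := conc _ tc0 tc1.
have -> : c / (b + c) * a + (1 - c / (b + c)) * (a + b + c) = a + b by field.
have -> : b / (b + c) * a + (1 - b / (b + c)) * (a + b + c) = a + c by field.
rewrite tbc; lra.
Qed.

Section Mixture.
Variables (R : realType) (Omega M : finType) (pM : M -> Omega -> R).
Implicit Types (w : nat -> R) (I J : seq M) (x : Omega).

Lemma mixture_nil w x : mixture w pM [::] x = 0.
Proof. by rewrite /mixture big_ord0. Qed.

Lemma mixture_cons w a I x :
  mixture w pM (a :: I) x =
  w 0%N * pM a x + mixture (fun j => w j.+1) pM I x.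
Proof.
rewrite /mixture big_ord_recl; congr (_ + _).
by apply: eq_bigr => i _; rewrite !(tnth_nth a).
Qed.

Lemma mixture_cat w I J x :
  mixture w pM (I ++ J) x =
  mixture w pM I x + mixture (fun j => w (size I + j)%N) pM J x.
Proof.
(* [w] is generalized because the tail of the list sees the weights shifted by one. *)
elim: I w => [|a I IHI] w /=; first by rewrite mixture_nil add0r.
by rewrite !mixture_cons IHI addrA.
Qed.

Lemma mixture_rcons w I a x :
  mixture w pM (rcons I a) x = mixture w pM I x + w (size I) * pM a x.
Proof.
by rewrite -cats1 mixture_cat mixture_cons mixture_nil addr0 addn0.
Qed.

Lemma mixture_ge0 w I x :
  (forall i y, 0 <= pM i y) -> (forall j, (j < size I)%N -> 0 <= w j) ->
  0 <= mixture w pM I x.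
Proof. by move=> pM0 w0; apply: sumr_ge0 => j _; rewrite mulr_ge0 ?w0. Qed.

End Mixture.

Section Overlap.
Variables (R : realType) (Omega M : finType) (k : nat).
Variables (p : Omega -> R) (pM : M -> Omega -> R) (w : nat -> R) (f : R -> R).
Hypothesis pM_ge0 : forall i x, 0 <= pM i x.
Hypothesis w_ge0 : forall j, (j < k)%N -> 0 <= w j.
Hypothesis f_deriv_gt0 : forall x, 0 < halfline_deriv f (p x).

Lemma overlap_ordered_submodular :
  (forall x y, 0 <= x -> x <= y -> f x <= f y) ->
  concave_function (halfline R) f ->
  ordered_submodular k (fun I : seq M => overlap f p (mixture w pM I)).
Proof.
move=> f_nondecr f_concave A B s s' sizeAB.
rewrite /overlap -!sumrB; apply: ler_sum => x _.
rewrite -!mulrBl ler_wpM2r ?invr_ge0 ?(ltW (f_deriv_gt0 x)) //.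
rewrite !mixture_cat !mixture_rcons !size_rcons.
(* [B] starts at the same position after [s] as after [s'], so a single [c] is its contribution to
   both lists. *)
set a := mixture w pM A x; set c := mixture _ pM B x.
have a0 : 0 <= a.
  by apply: mixture_ge0 => // j jA; rewrite w_ge0 //; lia.
have c0 : 0 <= c.
  by apply: mixture_ge0 => // j jB; rewrite w_ge0 //; lia.
have step0 i : 0 <= w (size A) * pM i x by rewrite mulr_ge0 ?w_ge0 //; lia.
apply: le_trans (concave_increments f_concave a0 (step0 s) c0).
(* What remains is to drop the nonnegative contribution of [s'] from the subtracted term. *)
rewrite lerD2l lerN2 f_nondecr ?addr_ge0 //.
by rewrite lerD2r lerDl.
Qed.

Lemma overlap_ge0 (I : seq M) :
  (forall x, 0 <= x -> 0 <= f x) -> (size I <= k)%N ->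
  0 <= overlap f p (mixture w pM I).
Proof.
move=> f_ge0 sizeI; apply: sumr_ge0 => x _.
rewrite divr_ge0 ?(ltW (f_deriv_gt0 x)) // f_ge0 // mixture_ge0 // => j jI.
by rewrite w_ge0 // (leq_trans jI).
Qed.

End Overlap.

Section Greedy.
Variables (R : realType) (M : finType) (F : seq M -> R).

Lemma greedy_size l A : greedy F l A -> size A = l.
Proof. by elim=> [//|{}l {}A a _ <- _]; rewrite size_rcons. Qed.

(** Keeps the bound on greedy lists from being vacuous; a movie is needed for the maximum to be
    attained. *)
Lemma greedy_exists l : (0 < #|M|)%N -> exists A, greedy F l A.
Proof.
move=> /card_gt0P[m _]; elim: l => [|l [A gA]].
  by exists [::]; apply: greedy_nil.
exists (rcons A [arg max_(a > m) F (rcons A a)]%O).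
by apply: greedy_rcons gA _ => b; case: arg_maxP => // a _; apply.
Qed.

(** The hybrid [A ++ drop l O] starts at [O] for [l = 0] and ends at [A] for [l = k]; the losses and
    the greedy gains both telescope. *)
Lemma greedy_exchange k l A O :
  ordered_submodular k F -> greedy F l A -> size O = k -> (l <= k)%N ->
  F O - F (A ++ drop l O) <= F A - F [::].
Proof.
move=> submod gA sizeO; elim: gA => [|{}l {}A a gA IHA a_max] lk.
  by rewrite drop0 !subrr.
have sizeA := greedy_size gA.
have dropO : A ++ drop l O = rcons A (nth a O l) ++ drop l.+1 O.
  by rewrite (drop_nth a) ?sizeO // cat_rcons.
have sizeAO : (size A + 1 + size (drop l.+1 O) <= k)%N.
  by rewrite size_drop sizeA; lia.
(* Here [s] is the movie of [O] at position [l] and [s'] the greedy choice [a]. The loss is at most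
   the gain of [s], which [a_max] bounds by the gain of [a]. *)
have := IHA (ltnW lk); have := submod _ _ (nth a O l) a sizeAO.
rewrite dropO; have := a_max (nth a O l); lra.
Qed.

Lemma greedy_half_max k A :
  (forall I, (size I <= k)%N -> 0 <= F I) -> ordered_submodular k F ->
  greedy F k A -> 2^-1 * max_value k F <= F A.
Proof.
move=> F_ge0 submod gA; have sizeA := greedy_size gA.
(* The first goal is the neutral element 0 of the maximum. *)
rewrite ler_pdivrMl //; apply: bigmax_le => [|O _].
  by rewrite mulr_ge0 ?F_ge0 ?sizeA.
have := greedy_exchange submod gA (size_tuple O) (leqnn k).
rewrite drop_oversize ?size_tuple // cats0.
(* Discarding [F [::]] leaves [F O <= 2 * F A]. *)
have := F_ge0 [::] (leq0n k); lra.
Qed.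

End Greedy.

Theorem theorem4 (R : realType) (Omega M : finType)
    (p : Omega -> R) (pM : M -> Omega -> R)
    (k : nat) (w : nat -> R) (f : R -> R)
    (hp : is_distribution p)
    (hpM : forall i : M, is_distribution (pM i))
    (hk : (1 <= k)%N)
    (hw_decr : forall i j : nat, (i <= j)%N -> (j < k)%N -> w j <= w i)
    (hw_ge0 : forall j : nat, (j < k)%N -> 0 <= w j)
    (hw_sum : \sum_(j < k) w j = 1)
    (hf_ge0 : forall x : R, 0 <= x -> 0 <= f x)
    (hf_nondecr : forall x y : R, 0 <= x -> x <= y -> f x <= f y)
    (hf_concave : concave_function (halfline R) f)
    (hf_derivable : forall x : R, 0 <= x -> halfline_derivable f x)
    (hf_deriv_gt0 : forall x : Omega, 0 < halfline_deriv f (p x)) :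
  let F := fun I : seq M => overlap f p (mixture w pM I) in
  [/\ ordered_submodular k F,
      ((0 < #|M|)%N -> exists A : seq M, greedy F k A)
    & forall A : seq M, greedy F k A ->
        size A = k /\ F A >= 2^-1 * max_value k F].
Proof.
move=> F.
have pM_ge0 i x : 0 <= pM i x by have [+ _] := hpM i; apply.
have submod : ordered_submodular k F by apply: overlap_ordered_submodular.
have F_ge0 I : (size I <= k)%N -> 0 <= F I.
  by move=> sizeI; apply: overlap_ge0 hf_ge0 sizeI.
split=> // [|A gA]; first exact: greedy_exists.
by split; [exact: greedy_size gA | exact: greedy_half_max gA].
Qed.
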